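(* Let $A$ be a normed algebra, $\mathcal{K}$ a class of right normed $A$-modules, and $Z$ a left normed $A$-module. Then $Z$ is extremely flat with respect to $\mathcal{K}$ if and only if its dual normed right $A$-module $Z^*$ is extremely injective with respect to $\mathcal{K}$.
   Context: All spaces are complex; normed algebras, spaces and modules are not assumed complete. All normed modules are assumed contractive: $\|a\cdot x\|\le\|a\|\|x\|$ (for left modules), $\|x\cdot a\|\le\|a\|\|x\|$ (for right modules). A morphism is a linear map commuting with the module multiplication; ''isometric'' means norm-preserving (not necessarily surjective). For a left normed $A$-module $Z$, the dual $Z^*$ is a right $A$-module via $(f\cdot a)(z)=f(a\cdot z)$. For a right normed $A$-module $X$ and a left normed $A$-module $Z$, the (non-completed) projective module tensor product $X\otimes_A Z$ is the quotient normed space of the non-completed projective tensor product $X\otimes_p Z$ of normed spaces by the closure of the linear span of all elements $(x\cdot a)\otimes z-x\otimes(a\cdot z)$. The image of $x\otimes z$ is denoted $x\otimes_A z$. For a bounded morphism $\varphi:X\to Y$ of right modules, $\varphi\otimes_A\mathbf{1}_Z:X\otimes_A Z\to Y\otimes_A Z$ is well defined by $x\otimes_A z\mapsto\varphi(x)\otimes_A z$. A left normed $A$-module $Z$ is extremely flat with respect to $\mathcal{K}$ if, for every isometric morphism $i:X\to Y$ of right modules belonging to $\mathcal{K}$, the operator $i\otimes_A\mathbf{1}_Z$ is also isometric. A right normed $A$-module $W$ is extremely injective with respect to $\mathcal{K}$ if, for every isometric morphism $i:X\to Y$ of right modules belonging to $\mathcal{K}$ and every bounded morphism $\varphi:X\to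 W$ of right $A$-modules, there exists a bounded morphism $\psi:Y\to W$ of right modules with $\psi\circ i=\varphi$ and $\|\psi\|=\|\varphi\|$. *)

(* Defs.v *)
From HB Require Import structures.
From mathcomp Require Import all_boot all_order all_algebra.
From mathcomp Require Import all_classical all_reals all_analysis.
From mathcomp.real_closed Require Import complex.
From mathcomp.multinomials Require Import freeg.
From mathcomp Require Import ring lra.

Set Implicit Arguments.
Unset Strict Implicit.
Unset Printing Implicit Defensive.

Import Order.TTheory GRing.Theory Num.Theory.
Import numFieldNormedType.Exports.

Local Open Scope classical_set_scope.
Local Open Scope quotient_scope.
Local Open Scope complex_scope.
Local Open Scope ring_scope.

(* In a [normedModType R[i]] the norm takes its values in [R[i]]; [nrm] is the
   same norm as a real number. *)
Definition nrm (R : realType) (V : normedModType R[i]) (x : V) : R :=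
  complex.Re `|x|.

Section Nrm.
Context {R : realType}.
Implicit Types V : normedModType R[i].

Lemma nrmE V (x : V) : `|x| = (nrm x)%:C.
Proof. by rewrite /nrm RRe_real// realE normr_ge0. Qed.

Lemma nrm_ge0 V (x : V) : 0 <= nrm x.
Proof. by rewrite -ler0c -nrmE. Qed.

Lemma ler_nrmD V (x y : V) : nrm (x + y) <= nrm x + nrm y.
Proof. by rewrite -lecR rmorphD /= -!nrmE ler_normD. Qed.

Lemma nrmN V (x : V) : nrm (- x) = nrm x.
Proof. by rewrite /nrm normrN. Qed.

Lemma nrmZ V (c : R[i]) (x : V) : nrm (c *: x) = nrm (c : R[i]^o) * nrm x.
Proof.
apply: (@complexI R); rewrite rmorphM /= -!nrmE normrZ.
by rewrite (nrmE (c : R[i]^o)).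
Qed.

Lemma nrm0 V : nrm (0 : V) = 0.
Proof. by rewrite /nrm normr0. Qed.

Lemma nrm_eq0 V (x : V) : nrm x = 0 -> x = 0.
Proof. by move=> x0; apply/eqP; rewrite -normr_eq0 nrmE x0. Qed.

Lemma nrm_real (t : R) : nrm (t%:C : R[i]^o) = `|t|.
Proof. by rewrite /nrm normc_def /= expr0n addr0 sqrtr_sqr. Qed.

Lemma nrmM (c d : R[i]^o) : nrm (c * d : R[i]^o) = nrm c * nrm d.
Proof. exact: (nrmZ c d). Qed.

Lemma Re_le_nrm (c : R[i]^o) : complex.Re c <= nrm c.
Proof.
rewrite (le_trans (ler_norm _))// -lecR -nrmE.
exact: normc_ge_Re.
Qed.

End Nrm.

Section InfLemmas.
Context {R : realType}.

Lemma inf_leD (A B C : set R) : A !=set0 -> B !=set0 -> has_lbound C ->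
  (forall a b, A a -> B b -> exists2 c, C c & c <= a + b) ->
  inf C <= inf A + inf B.
Proof.
move=> A0 B0 C0 h; rewrite -lerBlDr; apply: lb_le_inf => // a Aa.
rewrite lerBlDr -lerBlDl; apply: lb_le_inf => // b Bb.
rewrite lerBlDl; have [c Cc cab] := h a b Aa Bb.
exact: le_trans (ge_inf C0 Cc) cab.
Qed.

Lemma inf_leZ (A B : set R) (r : R) : 0 < r -> A !=set0 -> has_lbound B ->
  (forall a, A a -> exists2 b, B b & b <= r * a) ->
  inf B <= r * inf A.
Proof.
move=> r0 A0 B0 h; rewrite -ler_pdivrMl//; apply: lb_le_inf => // a Aa.
rewrite ler_pdivrMl//; have [b Bb ba] := h a Aa.
exact: le_trans (ge_inf B0 Bb) ba.
Qed.

End InfLemmas.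

(* The Hahn-Banach theorem is used below to show that the projective tensor
   seminorm is a norm. *)
Section HahnBanach.
Context {R : realType} {V : lmodType R[i]}.
Implicit Types (p q : V -> R) (N : submodClosed V).

Definition sublinear q := (forall u v, q (u + v) <= q u + q v) /\
  (forall t v, 0 <= t -> q (t%:C *: v) = t * q v).

Definition real_linear q := (forall u v, q (u + v) = q u + q v) /\
  (forall t v, q (t%:C *: v) = t * q v).

Let sublinear0 q : sublinear q -> q 0 = 0.
Proof. by case=> _ /(_ 0 0 (lexx _)); rewrite scaler0 mul0r. Qed.

Let sublinearN q v : sublinear q -> - q (- v) <= q v.
Proof.
move=> sq; have := sq.1 v (- v); rewrite subrr sublinear0//; lra.
Qed.

Let sublinearI q : q 0 = 0 -> (forall u v, q (u + v) <= q u + q v) ->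
  (forall t v, 0 < t -> q (t%:C *: v) <= t * q v) -> sublinear q.
Proof.
move=> q0 qD qZ; split=> // t v; rewrite le_eqVlt => /predU1P[<-|t0].
  by rewrite scale0r q0 mul0r.
apply/le_anti; rewrite qZ//= -ler_pdivlMl//.
have := qZ t^-1 (t%:C *: v); rewrite invr_gt0 => /(_ t0).
rewrite scalerA -rmorphM /= mulVf ?gt_eqF// scale1r; exact.
Qed.

Let minimal_sublinear p : sublinear p -> exists q, [/\ sublinear q,
  forall v, q v <= p v & forall q', sublinear q' ->
    (forall v, q' v <= q v) -> q' = q].
Proof.
move=> sp; pose T := {q | sublinear q /\ forall v, q v <= p v}.
pose le (s t : T) : bool := `[< forall v, sval t v <= sval s v >].
have [|r s t /asboolP rs /asboolP st|s t /asboolP st /asboolP ts|A Atot|] :=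
  @Zorn T le.
- by move=> t; apply/asboolP.
- by apply/asboolP => v; exact: le_trans (st v) (rs v).
- case: s t st ts => [s hs] [t ht] /= st ts; apply: eq_exist.
  by apply/funext => v; apply/le_anti; rewrite st ts.
- have [[s0 As0]|A0] := pselect (exists s, A s); last first.
    exists (exist _ p (conj sp (fun v => lexx _))) => s As.
    by exfalso; apply: A0; exists s.
  pose E v := [set sval s v | s in A].
  have E0 v : E v !=set0 by exists (sval s0 v), s0.
  have Elb v : lbound (E v) (- p (- v)).
    move=> _ [s As <-]; apply: le_trans (sublinearN v (svalP s).1).
    by rewrite lerN2; exact: (svalP s).2.
  have Eb v : has_lbound (E v) by exists (- p (- v)).
  pose q v := inf (E v).
  have q_le s v : A s -> q v <= sval s v.
    by move=> As; apply: ge_inf => //; exists s.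
  have qs : sublinear q.
    apply: sublinearI.
    - apply/le_anti/andP; split.
        by rewrite (le_trans (q_le _ _ As0))// sublinear0//; exact: (svalP s0).1.
      have := @lb_le_inf _ _ _ (E0 0) (Elb 0).
      by rewrite oppr0 (sublinear0 sp) oppr0.
    - move=> u v; apply: inf_leD => // _ _ [s As <-] [t At <-].
      have [/asboolP st|/asboolP ts] := Atot _ _ As At.
        exists (sval t (u + v)); first by exists t.
        by rewrite (le_trans ((svalP t).1.1 _ _))// lerD2r.
      exists (sval s (u + v)); first by exists s.
      by rewrite (le_trans ((svalP s).1.1 _ _))// lerD2l.
    - move=> t v t0; apply: inf_leZ => // _ [s As <-].
      exists (sval s (t%:C *: v)); first by exists s.
      by rewrite (svalP s).1.2// ltW.
  have qp v : q v <= p v.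
    by apply: le_trans (q_le _ _ As0) _; exact: (svalP s0).2.
  exists (exist _ q (conj qs qp)) => s As; apply/asboolP => v /=; exact: q_le.
move=> [q [sq qp]] qmin; exists q; split=> // q' sq' q'q.
have q'p v : q' v <= p v by exact: le_trans (q'q v) (qp v).
have /(_ _)/(congr1 sval) := qmin (exist _ q' (conj sq' q'p)).
by apply; apply/asboolP.
Qed.

Let minimal_real_linear q : sublinear q ->
  (forall q', sublinear q' -> (forall v, q' v <= q v) -> q' = q) ->
  real_linear q.
Proof.
move=> sq qmin.
have qD u v : q (u + v) = q u + q v.
  apply/le_anti; rewrite sq.1 /=.
  pose E x := [set q (x + t%:C *: v) - t * q v | t in [set t : R | 0 <= t]].
  have E0 x : E x !=set0 by exists (q (x + 0%:C *: v) - 0 * q v), 0 => /=.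
  have Elb x : lbound (E x) (- q (- x)).
    move=> _ [t /= t0 <-]; rewrite -sq.2//.
    have := sq.1 (x + t%:C *: v) (- x); rewrite addrAC subrr add0r; lra.
  have Eb x : has_lbound (E x) by exists (- q (- x)).
  have Ex x (t : R) : 0 <= t -> inf (E x) <= q (x + t%:C *: v) - t * q v.
    by move=> t0; apply: ge_inf => //; exists t.
  have Eq x : inf (E x) <= q x.
    by have := Ex x 0 (lexx _); rewrite scale0r addr0 mul0r subr0.
  have Esub : sublinear (fun x => inf (E x)).
    apply: sublinearI.
    - apply/le_anti; rewrite -{1}(sublinear0 sq) Eq/=.
      have := @lb_le_inf _ _ _ (E0 0) (Elb 0).
      by rewrite oppr0 (sublinear0 sq) oppr0.
    - move=> x y; apply: inf_leD => // _ _ [s /= s0 <-] [t /= t0 <-].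
      exists (q (x + y + (s + t)%:C *: v) - (s + t) * q v).
        by exists (s + t) => //=; rewrite addr_ge0.
      rewrite rmorphD /= scalerDl addrACA.
      have := sq.1 (x + s%:C *: v) (y + t%:C *: v); lra.
    - move=> r x r0; apply: inf_leZ => // _ [s /= s0 <-].
      exists (q (r%:C *: x + (r * s)%:C *: v) - (r * s) * q v).
        by exists (r * s) => //=; rewrite mulr_ge0// ltW.
      rewrite rmorphM /= -scalerA -scalerDr sq.2 ?(ltW r0)//; lra.
  have Eu : inf (E u) = q u by rewrite -[in RHS](qmin _ Esub Eq).
  by have := Ex u 1 ler01; rewrite Eu scale1r; lra.
split=> // t v.
have q0 := sublinear0 sq.
have qN x : q (- x) = - q x.
  by have := qD x (- x); rewrite subrr q0; lra.
have [t0|t0] := leP 0 t; first by rewrite sq.2.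
have Nt : 0 <= - t by rewrite oppr_ge0 ltW.
by have := sq.2 _ v Nt; rewrite rmorphN scaleNr qN; lra.
Qed.

Let submodN N v : v \in N -> - v \in N.
Proof. by move=> Nv; rewrite -scaleN1r rpredZ. Qed.

Lemma real_hahn_banach N p (f : V -> R) : sublinear p ->
  {in N &, forall u v, f (u + v) = f u + f v} ->
  {in N, forall v, forall t, f (t%:C *: v) = t * f v} ->
  {in N, forall v, f v <= p v} ->
  exists g, [/\ real_linear g, {in N, g =1 f} & forall v, g v <= p v].
Proof.
move=> sp fD fZ fp.
have f0 : f 0 = 0 by have := fZ 0 (rpred0 _) 0; rewrite scaler0 mul0r.
have fN n : n \in N -> f (- n) = - f n.
  move=> Nn; have := fZ _ Nn (-1); rewrite rmorphN scaleN1r; lra.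
pose E v := [set p (v - n) + f n | n in [set n | n \in N]].
have E0 v : E v !=set0 by exists (p (v - 0) + f 0), 0 => //=; exact: rpred0.
have Elb v : lbound (E v) (- p (- v)).
  move=> _ [n /= Nn <-].
  have NNn := submodN Nn.
  have := fp _ NNn; rewrite fN//.
  have := sp.1 (v - n) (- v); rewrite addrAC subrr add0r; lra.
have Eb v : has_lbound (E v) by exists (- p (- v)).
have Ele v n : n \in N -> inf (E v) <= p (v - n) + f n.
  by move=> Nn; apply: ge_inf => //; exists n.
have Ep v : inf (E v) <= p v.
  by have := Ele v 0 (rpred0 _); rewrite subr0 f0 addr0.
have sE : sublinear (fun v => inf (E v)).
  apply: sublinearI.
  - apply/le_anti; rewrite -{1}(sublinear0 sp) Ep/=.
    have := @lb_le_inf _ _ _ (E0 0) (Elb 0).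
    by rewrite oppr0 (sublinear0 sp) oppr0.
  - move=> x y; apply: inf_leD => // _ _ [m /= Nm <-] [n /= Nn <-].
    exists (p (x + y - (m + n)) + f (m + n)).
      by exists (m + n) => //=; rewrite rpredD.
    rewrite fD// opprD addrACA.
    have := sp.1 (x - m) (y - n); lra.
  - move=> r x r0; apply: inf_leZ => // _ [n /= Nn <-].
    exists (p (r%:C *: x - r%:C *: n) + f (r%:C *: n)).
      by exists (r%:C *: n) => //=; rewrite rpredZ.
    by rewrite -scalerBr fZ// sp.2 ?(ltW r0)//; lra.
have [g [sg gE gmin]] := minimal_sublinear sE.
have lg := minimal_real_linear sg gmin.
exists g; split=> //; last by move=> v; exact: le_trans (gE v) (Ep v).
have gf n : n \in N -> g n <= f n.
  move=> Nn; apply: le_trans (gE n) _.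
  by have := Ele n n Nn; rewrite subrr (sublinear0 sp) add0r.
move=> n Nn; apply/le_anti; rewrite gf//=.
have := gf _ (submodN Nn); rewrite fN//.
by have := lg.2 (-1) n; rewrite rmorphN scaleN1r; lra.
Qed.

Lemma hahn_banach N p (f : V -> R[i]^o) :
  (forall u v, p (u + v) <= p u + p v) ->
  (forall c v, p (c *: v) = nrm (c : R[i]^o) * p v) ->
  (forall c, {in N &, forall u v, f (c *: u + v) = c * f u + f v}) ->
  {in N, forall v, nrm (f v) <= p v} ->
  exists g : {linear V -> R[i]^o},
    {in N, g =1 f} /\ forall v, nrm (g v) <= p v.
Proof.
move=> pD pZ flin fp.
have sp : sublinear p by split=> // t v t0; rewrite pZ nrm_real ger0_norm.
have f0 : f 0 = 0.
  have := flin (-1) _ _ (rpred0 N) (rpred0 N).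
  by rewrite scaler0 addr0 mulN1r addNr.
have fZ c v : v \in N -> f (c *: v) = c * f v.
  by move=> Nv; have := flin c _ _ Nv (rpred0 N); rewrite !addr0 f0 addr0.
have [||| h [lh hf hp]] := @real_hahn_banach N p (fun v => complex.Re (f v)) sp.
- move=> u v Nu Nv /=.
  by have := flin 1 _ _ Nu Nv; rewrite scale1r mul1r => ->; rewrite raddfD.
- move=> v Nv t /=; rewrite fZ//.
  by case: (f v) => a b /=; rewrite mul0r subr0.
- move=> v Nv; apply: le_trans (fp _ Nv); exact: Re_le_nrm.
pose g v : R[i]^o := h v +i* (- h ('i%C *: v)).
have hN v : h (- v) = - h v.
  by have := lh.2 (-1) v; rewrite rmorphN scaleN1r mulN1r.
have gl : linear g.
  move=> c u v; rewrite /g !lh.1 scalerDr !lh.1.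
  case: c => a b.
  have e x : (a +i* b) *: x = a%:C *: x + b%:C *: ('i%C *: x).
    rewrite scalerA -scalerDl; congr (_ *: _).
    by apply/eqP; rewrite eq_complex /= !mul0r !mulr0 mulr1 subr0 !addr0 add0r !eqxx.
  have ii x : 'i%C *: ('i%C *: x) = - x.
    rewrite scalerA (_ : _ * _ = -1) ?scaleN1r//.
    by apply/eqP; rewrite eq_complex /= !(mul0r, mul1r, sub0r, add0r, oppr0) !eqxx.
  rewrite scalerA mulrC -scalerA !e !lh.1 !lh.2 ii hN.
  rewrite /GRing.scale /=; apply/eqP; rewrite eq_complex /=.
  by apply/andP; split; apply/eqP; ring.
pose G : {linear V -> R[i]^o} := HB.pack g (GRing.isLinear.Build _ _ _ _ g gl).
exists G; split.
- move=> v Nv /=; rewrite /g hf//= hf/= ?rpredZ// fZ//.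
  by case: (f v) => a b /=; rewrite mul0r mul1r sub0r opprK.
- move=> v; have [->|Gv0] := eqVneq (G v) 0.
    rewrite nrm0; have := sublinearN v sp.
    have : p (- v) = p v.
      rewrite -scaleN1r (_ : -1 = (-1)%:C); last by rewrite rmorphN1.
      by rewrite pZ nrm_real normrN1 mul1r.
    by move=> ->; lra.
  pose c : R[i] := `|G v| / G v.
  have cG : c * G v = `|G v| by rewrite /c divfK.
  have c1 : nrm (c : R[i]^o) = 1.
    by rewrite /nrm /c normf_div normr_id divff// normr_eq0.
  have : complex.Re (G (c *: v)) <= p (c *: v) by exact: hp.
  have -> : G (c *: v) = `|G v| by rewrite linearZ.
  by rewrite pZ c1 mul1r.
Qed.

End HahnBanach.

Section BoundedOperators.
Context {R : realType}.
Implicit Types V W : normedModType R[i].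

Definition bounded_op V W (f : V -> W) : Prop :=
  exists M : R, forall v, nrm (f v) <= M * nrm v.

Definition opnorm V W (f : V -> W) : R :=
  sup [set nrm (f v) | v in [set v | nrm v <= 1]].

Definition isometric V W (f : V -> W) : Prop := forall v, `|f v| = `|v|.

Lemma opnorm_le V W (f : V -> W) (M : R) : 0 <= M ->
  (forall v, nrm (f v) <= M * nrm v) -> opnorm f <= M.
Proof.
move=> M0 fM; apply: ge_sup.
  by exists (nrm (f 0)), 0 => //=; rewrite nrm0.
move=> _ [v /= v1 <-]; apply: le_trans (fM v) _.
by rewrite -[leRHS]mulr1 ler_wpM2l.
Qed.

Lemma opnorm_ub V W (f : V -> W) v : bounded_op f -> nrm v <= 1 ->
  nrm (f v) <= opnorm f.
Proof.
move=> [M fM] v1; apply: ub_le_sup; last by exists v.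
exists `|M| => _ [w /= w1 <-]; apply: le_trans (fM w) _.
apply: (@le_trans _ _ (`|M| * nrm w)); first by rewrite ler_wpM2r ?nrm_ge0 ?ler_norm.
by rewrite -[leRHS]mulr1 ler_wpM2l.
Qed.

Lemma opnorm_ge0 V W (f : V -> W) : bounded_op f -> 0 <= opnorm f.
Proof.
move=> bf; apply: le_trans (opnorm_ub (v := 0) bf _); first exact: nrm_ge0.
by rewrite nrm0.
Qed.

Lemma nrm_le_opnorm V W (f : V -> W) v : linear f -> bounded_op f ->
  nrm (f v) <= opnorm f * nrm v.
Proof.
move=> lf bf; pose F : {linear V -> W} := HB.pack f (GRing.isLinear.Build _ _ _ _ f lf).
have [->|v0] := eqVneq v 0.
  by rewrite (_ : f 0 = 0) ?nrm0 ?mulr0//; exact: (linear0 F).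
have nv0 : 0 < nrm v.
  by rewrite lt0r nrm_ge0 andbT; apply: contra_neq v0; exact: nrm_eq0.
rewrite -ler_pdivrMr//.
have nw c : 0 <= c -> nrm (c%:C : R[i]^o) = c by move=> c0; rewrite nrm_real ger0_norm.
have e : f ((nrm v)^-1%:C *: v) = (nrm v)^-1%:C *: f v by exact: (linearZ_LR F).
have := @opnorm_ub _ _ f ((nrm v)^-1%:C *: v) bf.
rewrite e !nrmZ nw ?invr_ge0 ?nrm_ge0// mulVf ?gt_eqF// lexx => /(_ isT).
by rewrite mulrC.
Qed.

End BoundedOperators.

Section Dual.
Context {R : realType} {Z : normedModType R[i]}.

Definition bounded_functional : {pred Z -> R[i]^o} :=
  [pred f : Z -> R[i]^o | `[< linear f /\ bounded_op f >]].

Let bounded_functional_closed : submod_closed bounded_functional.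
Proof.
split; first apply/asboolP; first split.
- by move=> c u v /=; rewrite /GRing.scale /= mulr0 addr0.
- by exists 0 => v; rewrite mul0r nrm0.
move=> c f g /asboolP[lf [M fM]] /asboolP[lg [N gN]]; apply/asboolP; split.
- move=> d u v.
  have e w : (c *: f + g) w = c *: f w + g w by [].
  by rewrite !e lf lg !scalerDr !scalerA (mulrC c) addrACA.
- exists (nrm (c : R[i]^o) * M + N) => v.
  apply: le_trans (ler_nrmD _ _) _; rewrite mulrDl lerD// nrmZ -mulrA.
  by rewrite ler_wpM2l// nrm_ge0.
Qed.

HB.instance Definition _ :=
  GRing.isSubmodClosed.Build _ _ bounded_functional bounded_functional_closed.

End Dual.

Record dual (R : realType) (Z : normedModType R[i]) := Dual {
  dual_fun :> Z -> R[i]^o;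
  _ : dual_fun \in bounded_functional }.

Section DualNormed.
Context {R : realType} (Z : normedModType R[i]).

HB.instance Definition _ := [isSub for @dual_fun R Z].
HB.instance Definition _ := [Choice of dual Z by <:].
HB.instance Definition _ := [SubChoice_isSubLmodule of dual Z by <:].

Implicit Types f g : dual Z.

Lemma dual_linear f : linear f.
Proof. by case: f => f /= /asboolP[]. Qed.

Lemma dual_bounded f : bounded_op f.
Proof. by case: f => f /= /asboolP[]. Qed.

Let dnorm f : R[i] := (opnorm f)%:C.

Let dnormD f g : dnorm (f + g) <= dnorm f + dnorm g.
Proof.
rewrite /dnorm -rmorphD lecR; have fb := dual_bounded f; have gb := dual_bounded g.
apply: opnorm_le => [|v]; first by rewrite addr_ge0// opnorm_ge0.
rewrite mulrDl (le_trans (ler_nrmD _ _))// lerD//; apply: nrm_le_opnorm => //;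
  exact: dual_linear.
Qed.

Let opnormZ_le c f : opnorm (c *: f) <= nrm (c : R[i]^o) * opnorm f.
Proof.
have fb := dual_bounded f.
apply: opnorm_le => [|v]; first by rewrite mulr_ge0 ?nrm_ge0// opnorm_ge0.
rewrite [(c *: f) v]/(c *: f v) nrmZ -mulrA ler_wpM2l ?nrm_ge0//.
exact/nrm_le_opnorm/fb/dual_linear.
Qed.

Let dnormZ c f : dnorm (c *: f) = `|c| * dnorm f.
Proof.
rewrite (nrmE (c : R[i]^o)) /dnorm -rmorphM; congr (_%:C); apply/le_anti.
rewrite opnormZ_le/=; have [->|c0] := eqVneq c 0.
  by rewrite nrm0 mul0r opnorm_ge0//; exact: (dual_bounded (0 *: f)).
have nc : 0 < nrm (c : R[i]^o).
  by rewrite lt0r nrm_ge0 andbT; apply: contra_neq c0; exact: nrm_eq0.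
rewrite -ler_pdivlMl//; apply: le_trans (_ : opnorm (c^-1 *: (c *: f)) <= _).
  by rewrite scalerA mulVf// scale1r.
apply: le_trans (opnormZ_le _ _) _; rewrite ler_wpM2r//.
  exact/opnorm_ge0/dual_bounded.
rewrite -[leRHS]mulr1 -ler_pdivrMl ?invr_gt0// invrK -nrmM mulfV//.
by rewrite /nrm normr1.
Qed.

Let dnorm0_eq0 f : dnorm f = 0 -> f = 0.
Proof.
move=> /(@complexI R) f0; apply/val_inj/funext => v /=; apply: nrm_eq0.
apply/le_anti; rewrite nrm_ge0 andbT.
have := @nrm_le_opnorm _ _ _ f v (dual_linear f) (dual_bounded f).
by rewrite f0 mul0r.
Qed.

HB.instance Definition _ :=
  Lmodule_isNormed.Build R[i] (dual Z) dnormD dnormZ dnorm0_eq0.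

Lemma dual_normE f : `|f| = (opnorm f)%:C. Proof. by []. Qed.

End DualNormed.

Section LinearSpan.
Context {K : numDomainType} {V : lmodType K}.

Definition linear_span (G : set V) : {pred V} := [pred v |
  `[< smallest [set S : set V |
        S 0 /\ forall c u w, S u -> S w -> S (c *: u + w)] G v >]].

Let linear_span_closed G : submod_closed (linear_span G).
Proof.
split; first by apply/asboolP => S [[S0 _] _].
move=> c u v /asboolP Gu /asboolP Gv; apply/asboolP => S GS.
by apply GS.1.2; [exact: Gu|exact: Gv].
Qed.

HB.instance Definition _ G :=
  GRing.isSubmodClosed.Build _ _ (linear_span G) (linear_span_closed G).

End LinearSpan.

Section QuotientModule.
Context {K : numDomainType} {V : lmodType K} (N : submodClosed V).

Definition submod_pred : {pred V} := [pred v | v \in N].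

Let submod_pred_closed : zmod_closed submod_pred.
Proof.
split=> [|u v Nu Nv]; rewrite inE; first exact: rpred0.
by rewrite rpredD// -scaleN1r rpredZ.
Qed.

HB.instance Definition _ :=
  GRing.isZmodClosed.Build V submod_pred submod_pred_closed.

Definition quotmod := Quotient.quot submod_pred.

HB.instance Definition _ := GRing.Zmodule.on quotmod.

Definition quotmod_pi (v : V) : quotmod := \pi v.

Lemma quotmod_piP (u v : V) :
  quotmod_pi u = quotmod_pi v <-> u - v \in N.
Proof.
rewrite -[_ \in N]/(u - v \in submod_pred) Quotient.idealrBE.
by split=> [/eqP|/eqP].
Qed.

Lemma quotmod_reprK (x : quotmod) : quotmod_pi (repr x) = x.
Proof. exact: reprK. Qed.

Lemma quotmod_piD u v : quotmod_pi (u + v) = quotmod_pi u + quotmod_pi v.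
Proof. by rewrite /quotmod_pi !piE. Qed.

Let scale (c : K) (x : quotmod) : quotmod := quotmod_pi (c *: repr x).

Let scale_pi c v : scale c (quotmod_pi v) = quotmod_pi (c *: v).
Proof.
apply/quotmod_piP; rewrite -scalerBr rpredZ//; apply/quotmod_piP.
exact: quotmod_reprK.
Qed.

Let scaleA a b x : scale a (scale b x) = scale (a * b) x.
Proof. by rewrite -(quotmod_reprK x) !scale_pi scalerA. Qed.

Let scale1 x : scale 1 x = x.
Proof. by rewrite -(quotmod_reprK x) !scale_pi scale1r. Qed.

Let scaleDr a x y : scale a (x + y) = scale a x + scale a y.
Proof.
rewrite -(quotmod_reprK x) -(quotmod_reprK y) -quotmod_piD !scale_pi.
by rewrite scalerDr quotmod_piD.
Qed.

Let scaleDl x a b : scale (a + b) x = scale a x + scale b x.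
Proof. by rewrite -(quotmod_reprK x) !scale_pi scalerDl quotmod_piD. Qed.

HB.instance Definition _ :=
  GRing.Zmodule_isLmodule.Build K quotmod scaleA scale1 scaleDr scaleDl.

Let quotmod_pi_linear : linear quotmod_pi.
Proof. by move=> c u v; rewrite quotmod_piD -scale_pi. Qed.

HB.instance Definition _ :=
  GRing.isLinear.Build K V quotmod _ quotmod_pi quotmod_pi_linear.

End QuotientModule.

Section ClosureSubmodule.
Context {R : realType} {V : normedModType R[i]} (N : submodClosed V).

Definition closure_submod : {pred V} := [pred v | `[< closure [set` N] v >]].

Lemma closure_submodP v : reflect
  (forall e : R, 0 < e -> exists2 n, n \in N & nrm (v - n) < e)
  (v \in closure_submod).
Proof.
apply: (iffP (asboolP _)).
- move=> Nv e e0.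
  have /Nv[n [/= Nn vn]] : nbhs v (ball v e%:C) by apply: nbhsx_ballx; rewrite ltcR.
  by exists n => //; move: vn; rewrite -ball_normE /= nrmE ltcR.
- move=> h B /nbhs_ballP[e /= e0 vB].
  have eE : e = (complex.Re e)%:C by rewrite RRe_real// gtr0_real.
  have [|n Nn vn] := h (complex.Re e); first by rewrite -ltcR -eE.
  by exists n; split=> //; apply: vB; rewrite -ball_normE /= nrmE eE ltcR.
Qed.

Let closure_submod_closed : submod_closed closure_submod.
Proof.
split; first by apply/closure_submodP => e e0; exists 0; rewrite ?rpred0// subrr nrm0.
move=> c u v /closure_submodP Nu /closure_submodP Nv.
apply/closure_submodP => e e0.
have c0 : 0 < 1 + nrm (c : R[i]^o) by rewrite ltr_pwDl// nrm_ge0.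
have [|m Nm um] := Nu (e / 2 / (1 + nrm (c : R[i]^o))).
  by rewrite !divr_gt0.
have [|n Nn vn] := Nv (e / 2); first by rewrite divr_gt0.
exists (c *: m + n); first by rewrite rpredD// rpredZ.
rewrite opprD addrACA -scalerBr (le_lt_trans (ler_nrmD _ _))// nrmZ.
rewrite (splitr e) ler_ltD//.
move: um; rewrite ltr_pdivlMr// mulrDr mulr1 mulrC; have := nrm_ge0 (u - m); lra.
Qed.

HB.instance Definition _ :=
  GRing.isSubmodClosed.Build _ _ closure_submod closure_submod_closed.

End ClosureSubmodule.

(* The quotient of a normed space by the closure of a subspace, normed by the
   infimum of the norms of the representatives. *)
Section QuotientNormed.
Context {R : realType} {V : normedModType R[i]} (N : submodClosed V).

Definition quotnorm_type := quotmod (closure_submod N).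

HB.instance Definition _ := GRing.Lmodule.on quotnorm_type.

Let pi (v : V) : quotnorm_type := quotmod_pi (closure_submod N) v.

Let pi_linear : linear pi.
Proof. exact: (linearP (quotmod_pi (closure_submod N))). Qed.

HB.instance Definition _ :=
  GRing.isLinear.Build _ V quotnorm_type _ pi pi_linear.

Let reprs (x : quotnorm_type) : set R := [set nrm v | v in [set v | pi v = x]].

Let qnorm (x : quotnorm_type) : R[i] := (inf (reprs x))%:C.

Let reprs0 x : reprs x !=set0.
Proof. by exists (nrm (repr x)), (repr x) => //; exact: quotmod_reprK. Qed.

Let reprs_lb x : lbound (reprs x) 0.
Proof. by move=> _ [v _ <-]; exact: nrm_ge0. Qed.

Let reprs_hlb x : has_lbound (reprs x).
Proof. by exists 0; exact: reprs_lb. Qed.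

Let qnormD x y : qnorm (x + y) <= qnorm x + qnorm y.
Proof.
rewrite /qnorm -rmorphD lecR; apply: inf_leD => // _ _ [u <- <-] [v <- <-].
exists (nrm (u + v)); last exact: ler_nrmD.
by exists (u + v) => //; rewrite /= linearD.
Qed.

Let qnormZ_le c x : c != 0 -> inf (reprs (c *: x)) <= nrm (c : R[i]^o) * inf (reprs x).
Proof.
move=> c0; apply: inf_leZ => //.
  by rewrite lt0r nrm_ge0 andbT; apply: contra_neq c0; exact: nrm_eq0.
move=> _ [v <- <-]; exists (nrm (c *: v)); last by rewrite nrmZ.
by exists (c *: v) => //; rewrite /= linearZ.
Qed.

Let qnorm0 : inf (reprs 0) = 0.
Proof.
apply/le_anti; rewrite (lb_le_inf (reprs0 _) (reprs_lb (x := _)))// andbT.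
by apply: ge_inf => //; exists 0; rewrite ?nrm0//= linear0.
Qed.

Let qnormZ c x : qnorm (c *: x) = `|c| * qnorm x.
Proof.
rewrite (nrmE (c : R[i]^o)) /qnorm -rmorphM; congr (_%:C).
have [->|c0] := eqVneq c 0; first by rewrite scale0r qnorm0 nrm0 mul0r.
apply/le_anti; rewrite qnormZ_le//=.
have nc : 0 < nrm (c : R[i]^o).
  by rewrite lt0r nrm_ge0 andbT; apply: contra_neq c0; exact: nrm_eq0.
rewrite -ler_pdivlMl//.
have := @qnormZ_le c^-1 (c *: x) (invr_neq0 c0).
rewrite scalerA mulVf// scale1r => /le_trans; apply.
rewrite ler_wpM2r ?(lb_le_inf (reprs0 _) (reprs_lb (x := _)))//.
rewrite -[leRHS]mulr1 -ler_pdivrMl ?invr_gt0// invrK -nrmM mulfV//.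
by rewrite /nrm normr1.
Qed.

Let qnorm0_eq0 x : qnorm x = 0 -> x = 0.
Proof.
move=> /(@complexI R) x0; rewrite -(quotmod_reprK x) -(linear0 pi).
apply/quotmod_piP/closure_submodP => e e0; rewrite subr0.
have [||_ [v vx <-]] := @inf_adherent _ (reprs x) (e / 2).
  by rewrite divr_gt0.
  by split; [exact: reprs0|exact: reprs_hlb].
rewrite x0 add0r => ve.
have : repr x - v \in closure_submod N.
  by apply/quotmod_piP; rewrite quotmod_reprK -vx.
move=> /closure_submodP /(_ (e / 2)) []; first by rewrite divr_gt0.
move=> n Nn xvn; exists n => //.
rewrite (_ : repr x - n = repr x - v - n + v); last first.
  by rewrite [RHS]addrAC subrK.
by rewrite (le_lt_trans (ler_nrmD _ _))// (splitr e) ltrD.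
Qed.

HB.instance Definition _ :=
  Lmodule_isNormed.Build R[i] quotnorm_type qnormD qnormZ qnorm0_eq0.

Definition quotnorm : normedModType R[i] := quotnorm_type.

Definition quotnorm_pi (v : V) : quotnorm := quotmod_pi (closure_submod N) v.

Let quotnorm_pi_linear : linear quotnorm_pi.
Proof. exact: pi_linear. Qed.

HB.instance Definition _ :=
  GRing.isLinear.Build R[i] V quotnorm _ quotnorm_pi quotnorm_pi_linear.

Definition quotnorm_repr (x : quotnorm) : V := repr (x : quotnorm_type).

Lemma quotnorm_reprK (x : quotnorm) : quotnorm_pi (quotnorm_repr x) = x.
Proof. exact: quotmod_reprK. Qed.

Lemma quotnorm_piP (u v : V) :
  quotnorm_pi u = quotnorm_pi v <-> u - v \in closure_submod N.
Proof. exact: quotmod_piP. Qed.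

Lemma quotnorm_pi_eq0 (u : V) : quotnorm_pi u = 0 <-> u \in closure_submod N.
Proof. by have := quotnorm_piP u 0; rewrite linear0 subr0. Qed.

Lemma quotnorm_normE (x : quotnorm) :
  `|x| = (inf [set nrm v | v in [set v | quotnorm_pi v = x]])%:C.
Proof. by []. Qed.

End QuotientNormed.

(* Sealed for performance only: unification should not unfold the carrier. *)
#[global] Opaque quotnorm.

Section Separation.
Context {R : realType} {V : normedModType R[i]}.

Lemma linear_span1 (x v : V) : v \in linear_span [set x] ->
  exists c : R[i], v = c *: x.
Proof.
move=> /asboolP; apply: (@smallest_sub _ _ _ [set v | exists c, v = c *: x]).
  split; first by exists 0; rewrite scale0r.
  move=> a _ _ [c ->] [d ->]; exists (a * c + d).
  by rewrite scalerDl scalerA.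
by move=> _ ->; exists 1; rewrite scale1r.
Qed.

Lemma exists_functional (x : V) : x != 0 ->
  exists g : {linear V -> R[i]^o}, g x = 1 /\ bounded_op g.
Proof.
move=> x0; pose f v : R[i]^o := xget 0 [set c | v = c *: x].
have fE c : f (c *: x) = c.
  apply: xget_unique => //= d /eqP; rewrite -subr_eq0 -scalerBl scaler_eq0.
  by rewrite (negbTE x0) orbF subr_eq0 => /eqP.
have nx0 : 0 < nrm x.
  by rewrite lt0r nrm_ge0 andbT; apply: contra_neq x0; exact: nrm_eq0.
have [||||g [gf gp]] := @hahn_banach R V (linear_span [set x])
    (fun v => (nrm x)^-1 * nrm v) f.
- by move=> u v; rewrite -mulrDr ler_wpM2l ?invr_ge0 ?nrm_ge0// ler_nrmD.
- by move=> c v; rewrite nrmZ mulrCA.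
- move=> c u v /linear_span1[a ->] /linear_span1[b ->].
  by rewrite scalerA -scalerDl !fE.
- move=> v /linear_span1[c ->].
  by rewrite fE nrmZ mulrCA mulVf ?gt_eqF// mulr1.
exists g; split; last by exists (nrm x)^-1.
rewrite gf; first by have := fE 1; rewrite scale1r.
by apply/asboolP; exact: sub_gen_smallest.
Qed.

Lemma span_or_functional (xs : seq V) (x : V) :
  (exists c : nat -> R[i], x = \sum_(i < size xs) c i *: xs`_i) \/
  (exists g : {linear V -> R[i]^o}, [/\ g x = 1, bounded_op g &
    forall i, (i < size xs)%N -> g xs`_i = 0]).
Proof.
elim: xs x => [|y xs IH] x.
  have [->|/exists_functional[g [gx gb]]] := eqVneq x 0.
    by left; exists (fun=> 0); rewrite big_ord0.
  by right; exists g.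
have [[c yE]|[h [hy hb h0]]] := IH y.
  have [[d xE]|[g [gx gb g0]]] := IH x.
    left; exists (fun i => if i is j.+1 then d j else 0).
    by rewrite big_ord_recl /= scale0r add0r.
  right; exists g; split=> // -[_|i /g0//] /=.
  rewrite yE linear_sum big1// => i _.
  by rewrite linearZ /= g0// scaler0.
have [[d xE]|[g [gx gb g0]]] := IH (x - h x *: y).
  left; exists (fun i => if i is j.+1 then d j else h x).
  by rewrite big_ord_recl /= -xE addrC subrK.
right; pose F v : R[i]^o := g (v - h v *: y).
have Flin : linear F.
  move=> c u v; rewrite /F -linearP; congr (g _).
  by rewrite linearP /= scalerDl -scalerA scalerBr opprD addrACA.
exists (HB.pack F (GRing.isLinear.Build _ _ _ _ F Flin) : {linear V -> R[i]^o}).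
split=> //=.
- have [M gM] := gb; have [K hK] := hb.
  exists (`|M| * (1 + `|K| * nrm y)) => v; rewrite /F.
  apply: le_trans (gM _) _.
  apply: (@le_trans _ _ (`|M| * nrm (v - h v *: y))).
    by rewrite ler_wpM2r ?nrm_ge0 ?ler_norm.
  rewrite -mulrA ler_wpM2l// (le_trans (ler_nrmD _ _))// nrmN mulrDl mul1r lerD2l.
  rewrite nrmZ mulrAC ler_wpM2r ?nrm_ge0// (le_trans (hK _))//.
  by rewrite ler_wpM2r ?nrm_ge0 ?ler_norm.
- move=> [_|i ixs] /=; rewrite /F.
    by rewrite hy scale1r subrr linear0.
  by rewrite h0// scale0r subr0 g0.
Qed.

End Separation.

Section QuotientLift.
Context {K : numDomainType} {V M : lmodType K} (N : submodClosed V).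

Definition quotmod_lift (f : V -> M) (x : quotmod N) : M := f (repr x).

Lemma quotmod_liftE (f : {linear V -> M}) v : {in N, forall n, f n = 0} ->
  quotmod_lift f (quotmod_pi N v) = f v.
Proof.
move=> fN; apply/eqP; rewrite -subr_eq0 -linearB; apply/eqP/fN.
by apply/quotmod_piP; rewrite quotmod_reprK.
Qed.

End QuotientLift.

Section FreeModule.
Context {K : numDomainType} {T : choiceType} {M : lmodType K}.

Lemma freeg_scaleU (c : K) (x : T) : << c *g x >> = c *: << x >>.
Proof.
by apply/eqP/freeg_eqP => y; rewrite coeffZ !coeffU mul1r.
Qed.

HB.instance Definition _ (f : T -> M) :=
  GRing.isZmodMorphism.Build {freeg T / K} M (fglift f) (lift_is_additive f).

Let fglift_scalable (f : T -> M) : scalable (fglift f : {freeg T / K} -> M).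
Proof.
move=> c u; rewrite -[in RHS](freeg_sumE u) [c *: u]/(fgscale c u) /fgscale.
rewrite !raddf_sum /=; apply: eq_bigr => x _.
by rewrite !liftU scalerA.
Qed.

HB.instance Definition _ (f : T -> M) :=
  GRing.isScalable.Build K {freeg T / K} M _ (fglift f) (fglift_scalable f).

End FreeModule.

(* The tensor product of vector spaces: free module on [X * Z] modulo the
   bilinearity relations. *)
Section AlgebraicTensor.
Context {K : numDomainType} (X Z : lmodType K).

Let gen (x : X) (z : Z) : {freeg (X * Z) / K} := << (x, z) >>.

Definition bilinearity_relations : set {freeg (X * Z) / K} :=
  [set w | (exists c x x' z, w = gen (c *: x + x') z - (c *: gen x z + gen x' z))
        \/ (exists c x z z', w = gen x (c *: z + z') - (c *: gen x z + gen x z'))].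

Definition tensor := quotmod (linear_span bilinearity_relations).

HB.instance Definition _ := GRing.Lmodule.on tensor.

Definition tens (x : X) (z : Z) : tensor := quotmod_pi _ (gen x z).

Let tens_linear_l z : linear (tens^~ z).
Proof.
move=> c x x' /=; rewrite /tens -linearP; apply/quotmod_piP/asboolP.
by apply: sub_gen_smallest; left; exists c, x, x', z.
Qed.

Let tens_linear_r x : linear (tens x).
Proof.
move=> c z z' /=; rewrite /tens -linearP; apply/quotmod_piP/asboolP.
by apply: sub_gen_smallest; right; exists c, x, z, z'.
Qed.

HB.instance Definition _ x := GRing.isLinear.Build K Z tensor _ (tens x) (tens_linear_r x).

Lemma tensDl x x' z : tens (x + x') z = tens x z + tens x' z.
Proof. by have := tens_linear_l z 1 x x'; rewrite !scale1r. Qed.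

Lemma tens0l z : tens 0 z = 0.
Proof. by apply: (addrI (tens 0 z)); rewrite -tensDl !addr0. Qed.

Lemma tensZl c x z : tens (c *: x) z = c *: tens x z.
Proof. by have := tens_linear_l z c x 0; rewrite tens0l !addr0. Qed.

Lemma tensor_sum (t : tensor) :
  exists s : seq (X * Z), t = \sum_(p <- s) tens p.1 p.2.
Proof.
rewrite -(quotmod_reprK t); move: (repr t) => D.
exists [seq (coeff p D *: p.1, p.2) | p <- dom D].
rewrite big_map -[in LHS](freeg_sumE D) linear_sum; apply: eq_bigr => p _ /=.
by rewrite freeg_scaleU tensZl linearZ; case: p.
Qed.

Lemma tensDr x z z' : tens x (z + z') = tens x z + tens x z'.
Proof. exact: linearD. Qed.

Lemma tensZr c x z : tens x (c *: z) = c *: tens x z.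
Proof. exact: linearZ. Qed.

Lemma tens0r x : tens x 0 = 0.
Proof. exact: linear0. Qed.

Lemma tens_absorb (s : seq (X * Z)) (x : X) (z : Z) (c : nat -> K) :
  x = \sum_(i < size s) c i *: (nth (0, 0) s i).1 ->
  tens x z + \sum_(p <- s) tens p.1 p.2 =
  \sum_(i < size s) tens (nth (0, 0) s i).1 ((nth (0, 0) s i).2 + c i *: z).
Proof.
move=> ->; rewrite (big_morph (fun x : X => tens x z)
  (fun x y => tensDl x y _) (tens0l _)).
rewrite (big_nth (0, 0)) big_mkord -big_split /=; apply: eq_bigr => i _.
by rewrite tensZl tensDr tensZr addrC.
Qed.

(* The linear map induced by a bilinear one. *)
Definition tensor_lift (M : lmodType K) (b : X -> Z -> M) : tensor -> M :=
  quotmod_lift (fglift (fun p : X * Z => b p.1 p.2)).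

Section Lift.
Variables (M : lmodType K) (b : X -> Z -> M).
Hypotheses (bl : forall z, linear (b^~ z)) (br : forall x, linear (b x)).

Let tensor_lift_pi (D : {freeg (X * Z) / K}) :
  tensor_lift b (quotmod_pi _ D) = fglift (fun p : X * Z => b p.1 p.2) D.
Proof.
apply: quotmod_liftE => w /asboolP.
apply: (@smallest_sub _ _ _ [set w | fglift (fun p : X * Z => b p.1 p.2) w = 0]).
  split; first exact: linear0.
  by move=> c u v /= u0 v0; rewrite linearP /= u0 v0 scaler0 addr0.
move=> _ /= [[c [x [x' [z ->]]]]|[c [x [z [z' ->]]]]]; rewrite linearB linearP /=;
  by rewrite !liftU /= !scale1r (bl, br) subrr.
Qed.

Lemma tensor_lift_linear : linear (tensor_lift b).
Proof.
move=> c u v; rewrite -(quotmod_reprK u) -(quotmod_reprK v).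
by rewrite -[X in tensor_lift b X]linearP !tensor_lift_pi linearP.
Qed.

Lemma tensor_liftE x z : tensor_lift b (tens x z) = b x z.
Proof. by rewrite tensor_lift_pi liftU scale1r. Qed.

Lemma tensor_lift_sum (s : seq (X * Z)) :
  tensor_lift b (\sum_(p <- s) tens p.1 p.2) = \sum_(p <- s) b p.1 p.2.
Proof.
pose L : {linear tensor -> M} := HB.pack (tensor_lift b)
  (GRing.isLinear.Build _ _ _ _ (tensor_lift b) tensor_lift_linear).
rewrite -[LHS]/(L _) linear_sum; apply: eq_bigr => p _.
exact: tensor_liftE.
Qed.

End Lift.

End AlgebraicTensor.

(* [ptensor X Z] is the algebraic tensor product (not completed) with the
   projective norm, see [ptensor_normE]. *)
Section ProjectiveTensor.
Context {R : realType} (X Z : normedModType R[i]).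

Definition ptensor_type := tensor X Z.

HB.instance Definition _ := GRing.Lmodule.on ptensor_type.

Let tn (x : X) (z : Z) : ptensor_type := tens x z.

Let costs (t : ptensor_type) : set R :=
  [set \sum_(p <- s) nrm p.1 * nrm p.2 |
     s in [set s : seq (X * Z) | t = \sum_(p <- s) tn p.1 p.2]].

Let pnorm (t : ptensor_type) : R[i] := (inf (costs t))%:C.

Let costs0 t : costs t !=set0.
Proof.
by have [s ts] := tensor_sum t; exists (\sum_(p <- s) nrm p.1 * nrm p.2), s.
Qed.

Let costs_lb t : lbound (costs t) 0.
Proof.
by move=> _ [s _ <-]; apply: sumr_ge0 => p _; rewrite mulr_ge0 ?nrm_ge0.
Qed.

Let costs_hlb t : has_lbound (costs t).
Proof. by exists 0; exact: costs_lb. Qed.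

Let pnormD t u : pnorm (t + u) <= pnorm t + pnorm u.
Proof.
rewrite /pnorm -rmorphD lecR; apply: inf_leD => // _ _ [r /= tr <-] [s /= us <-].
exists (\sum_(p <- r ++ s) nrm p.1 * nrm p.2); last by rewrite big_cat.
by exists (r ++ s) => //=; rewrite big_cat /= -tr -us.
Qed.

Let pnormZ_le c t : c != 0 -> inf (costs (c *: t)) <= nrm (c : R[i]^o) * inf (costs t).
Proof.
move=> c0; apply: inf_leZ => //.
  by rewrite lt0r nrm_ge0 andbT; apply: contra_neq c0; exact: nrm_eq0.
move=> _ [s /= ts <-]; pose s' := [seq (c *: p.1, p.2) | p <- s].
exists (\sum_(p <- s') nrm p.1 * nrm p.2).
  exists s' => //=; rewrite big_map ts scaler_sumr; apply: eq_bigr => p _.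
  by rewrite /tn tensZl.
rewrite big_map mulr_sumr le_eqVlt; apply/orP; left; apply/eqP.
by apply: eq_bigr => p _; rewrite nrmZ mulrA.
Qed.

Let pnorm0 : inf (costs 0) = 0.
Proof.
apply/le_anti; rewrite (lb_le_inf (costs0 _) (costs_lb (t := _)))// andbT.
by apply: ge_inf => //; exists [::]; rewrite /= ?big_nil.
Qed.

Let pnormZ c t : pnorm (c *: t) = `|c| * pnorm t.
Proof.
rewrite (nrmE (c : R[i]^o)) /pnorm -rmorphM; congr (_%:C).
have [->|c0] := eqVneq c 0; first by rewrite scale0r pnorm0 nrm0 mul0r.
apply/le_anti; rewrite pnormZ_le//=.
have nc : 0 < nrm (c : R[i]^o).
  by rewrite lt0r nrm_ge0 andbT; apply: contra_neq c0; exact: nrm_eq0.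
rewrite -ler_pdivlMl//.
have := @pnormZ_le c^-1 (c *: t) (invr_neq0 c0).
rewrite scalerA mulVf// scale1r => /le_trans; apply.
rewrite ler_wpM2r ?(lb_le_inf (costs0 _) (costs_lb (t := _)))//.
rewrite -[leRHS]mulr1 -ler_pdivrMl ?invr_gt0// invrK -nrmM mulfV//.
by rewrite /nrm normr1.
Qed.

(* Products of bounded functionals separate the points of the tensor product. *)
Let tensor_separated (s : seq (X * Z)) :
  (forall (f : {linear X -> R[i]^o}) (g : {linear Z -> R[i]^o}),
     bounded_op f -> bounded_op g -> \sum_(p <- s) f p.1 * g p.2 = 0) ->
  \sum_(p <- s) tens p.1 p.2 = 0.
Proof.
have [n] := ubnP (size s); elim: n s => // n IH [|p s] /= sn h.
  by rewrite big_nil.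
have nthE (F : X * Z -> R[i]^o) :
    \sum_(q <- s) F q = \sum_(i < size s) F (nth (0, 0) s i).
  by rewrite (big_nth (0, 0)) big_mkord.
have [[c pE]|[f [fp fb f0]]] := span_or_functional [seq q.1 | q <- s] p.1.
- rewrite size_map in pE.
  pose s' := [seq ((nth (0, 0) s i).1, (nth (0, 0) s i).2 + c i *: p.2)
             | i <- iota 0 (size s)].
  have {}pE : p.1 = \sum_(i < size s) c i *: (nth (0, 0) s i).1.
    by rewrite pE; apply: eq_bigr => i _; rewrite (nth_map (0, 0)).
  have s'E (M : zmodType) (F : X * Z -> M) :
      \sum_(q <- s') F q = \sum_(i < size s)
        F ((nth (0, 0) s i).1, (nth (0, 0) s i).2 + c i *: p.2).
    by rewrite big_map -[X in iota 0 X]subn0 -/(index_iota 0 _) big_mkord.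
  rewrite big_cons (tens_absorb _ pE) -[RHS](IH s').
  - by rewrite s'E.
  - by rewrite size_map size_iota.
  - move=> f g fb gb; rewrite s'E -[RHS](h f g fb gb) big_cons pE.
    rewrite nthE linear_sum mulr_suml -big_split /=; apply: eq_bigr => i _.
    rewrite linearD !linearZ /= mulrDr.
    by rewrite addrC; congr (_ + _); rewrite mulrCA mulrA.
- have p0 : p.2 = 0.
    apply/eqP/negPn/negP => /exists_functional[g [gp gb]].
    have := h f g fb gb; rewrite big_cons fp gp mulr1 nthE big1 ?addr0.
      by apply/eqP; rewrite oner_eq0.
    move=> i _; have := f0 i; rewrite size_map => /(_ (ltn_ord i)).
    by rewrite (nth_map (0, 0))// => ->; rewrite mul0r.
  rewrite big_cons p0 tens0r add0r; apply: IH => // f' g fb' gb.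
  by have := h f' g fb' gb; rewrite big_cons p0 linear0 mulr0 add0r.
Qed.

Let pnorm0_eq0 t : pnorm t = 0 -> t = 0.
Proof.
move=> /(@complexI R) t0; have [s ts] := tensor_sum t; rewrite ts.
apply: tensor_separated => f g [Mf fM] [Mg gM].
pose b (x : X) (z : Z) : R[i]^o := f x * g z.
have bl z : linear (b^~ z).
  by move=> c x x'; rewrite /b /= linearP mulrDl -scalerAl.
have br x : linear (b x).
  by move=> c z z'; rewrite /b /= linearP mulrDr -scalerAr.
rewrite -(tensor_lift_sum bl br) -ts; apply: nrm_eq0; apply/le_anti.
rewrite nrm_ge0 andbT.
have M0 : 0 < 1 + `|Mf| * `|Mg| by rewrite ltr_pwDl// mulr_ge0.
rewrite -(mulr0 (1 + `|Mf| * `|Mg|)) -ler_pdivrMl// -[leRHS]t0.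
apply: lb_le_inf => // _ [r /= tr <-]; rewrite tr ler_pdivrMl//.
rewrite (tensor_lift_sum bl br) mulr_sumr.
elim: r {tr} => [|p r IHr]; first by rewrite !big_nil nrm0.
rewrite !big_cons (le_trans (ler_nrmD _ _))// lerD// nrmM.
apply: (@le_trans _ _ ((`|Mf| * nrm p.1) * (`|Mg| * nrm p.2))).
  apply: ler_pM; rewrite ?nrm_ge0//.
    by apply: le_trans (fM _) _; rewrite ler_wpM2r ?nrm_ge0 ?ler_norm.
  by apply: le_trans (gM _) _; rewrite ler_wpM2r ?nrm_ge0 ?ler_norm.
rewrite mulrACA ler_wpM2r ?mulr_ge0 ?nrm_ge0//; lra.
Qed.

HB.instance Definition _ :=
  Lmodule_isNormed.Build R[i] ptensor_type pnormD pnormZ pnorm0_eq0.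

Definition ptensor : normedModType R[i] := ptensor_type.

Definition ptens (x : X) (z : Z) : ptensor := tens x z.

Lemma ptensDl x x' z : ptens (x + x') z = ptens x z + ptens x' z.
Proof. exact: tensDl. Qed.

Lemma ptensZl c x z : ptens (c *: x) z = c *: ptens x z.
Proof. exact: tensZl. Qed.

Lemma ptens0l z : ptens 0 z = 0.
Proof. exact: tens0l. Qed.

Lemma ptensDr x z z' : ptens x (z + z') = ptens x z + ptens x z'.
Proof. exact: tensDr. Qed.

Lemma ptensZr c x z : ptens x (c *: z) = c *: ptens x z.
Proof. exact: tensZr. Qed.

Lemma ptens0r x : ptens x 0 = 0.
Proof. exact: tens0r. Qed.

Lemma ptensor_sum (t : ptensor) :
  exists s : seq (X * Z), t = \sum_(p <- s) ptens p.1 p.2.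
Proof. exact: tensor_sum. Qed.

Lemma ptensor_normE (t : ptensor) :
  `|t| = (inf [set \sum_(p <- s) nrm p.1 * nrm p.2 |
     s in [set s : seq (X * Z) | t = \sum_(p <- s) ptens p.1 p.2]])%:C.
Proof. by []. Qed.

Lemma ptensor_nrm_le (s : seq (X * Z)) :
  nrm (\sum_(p <- s) ptens p.1 p.2) <= \sum_(p <- s) nrm p.1 * nrm p.2.
Proof. by rewrite /nrm ptensor_normE /=; apply: ge_inf (costs_hlb _) _ _; exists s. Qed.

Lemma ptensor_bounded (W : normedModType R[i]) (T : {linear ptensor -> W}) (M : R) :
  0 <= M -> (forall x z, nrm (T (ptens x z)) <= M * (nrm x * nrm z)) ->
  forall t, nrm (T t) <= M * nrm t.
Proof.
move=> M0 TM t; rewrite [in leRHS]/nrm ptensor_normE /=.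
have [t0|M1] := eqVneq M 0.
  have [s ->] := ptensor_sum t; rewrite t0 mul0r linear_sum.
  apply: le_trans (_ : \sum_(p <- s) nrm (T (ptens p.1 p.2)) <= _).
    elim: s => [|p s IH]; first by rewrite !big_nil nrm0.
    by rewrite !big_cons (le_trans (ler_nrmD _ _))// lerD2l.
  apply: (@le_trans _ _ (\sum_(p <- s) 0)); last by rewrite big1.
  by apply: ler_sum => p _; rewrite (le_trans (TM _ _))// t0 mul0r.
have {}M0 : 0 < M by rewrite lt0r M1.
rewrite -ler_pdivrMl//; apply: lb_le_inf => [|_ [s /= -> <-]]; first exact: costs0.
rewrite ler_pdivrMl// linear_sum mulr_sumr.
elim: s => [|p s IH]; first by rewrite !big_nil nrm0.
by rewrite !big_cons (le_trans (ler_nrmD _ _))// lerD.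
Qed.

End ProjectiveTensor.

#[global] Opaque ptensor.

(* Normed algebras need not be unital or complete. *)
Record normed_algebra (R : realType) := NormedAlgebra {
  alg_space :> normedModType R[i];
  alg_mul : alg_space -> alg_space -> alg_space;
  alg_mulA : associative alg_mul;
  alg_mul_linear_l : forall b, linear (alg_mul^~ b);
  alg_mul_linear_r : forall a, linear (alg_mul a);
  alg_norm_mul : forall a b, `|alg_mul a b| <= `|a| * `|b| }.

Record left_module (R : realType) (A : normed_algebra R) := LeftModule {
  lmod_space :> normedModType R[i];
  lact : A -> lmod_space -> lmod_space;
  lactA : forall a b z, lact (alg_mul a b) z = lact a (lact b z);
  lact_linear_l : forall z, linear (lact^~ z);
  lact_linear_r : forall a, linear (lact a);
  norm_lact : forall a z, `|lact a z| <= `|a| * `|z| }.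

Record right_module (R : realType) (A : normed_algebra R) := RightModule {
  rmod_space :> normedModType R[i];
  ract : rmod_space -> A -> rmod_space;
  ractA : forall x a b, ract x (alg_mul a b) = ract (ract x a) b;
  ract_linear_l : forall a, linear (ract^~ a);
  ract_linear_r : forall x, linear (ract x);
  norm_ract : forall x a, `|ract x a| <= `|a| * `|x| }.

Record bounded_morphism (R : realType) (A : normed_algebra R)
    (X Y : right_module A) := BoundedMorphism {
  bmor_map :> {linear X -> Y};
  bmor_act : forall x a, bmor_map (ract x a) = ract (bmor_map x) a;
  bmor_bounded : bounded_op bmor_map }.

Section DualModule.
Context {R : realType} {A : normed_algebra R} (Z : left_module A).

Let lact_le a (z : Z) : nrm (lact a z) <= nrm a * nrm z.
Proof. by rewrite -lecR rmorphM /= -!nrmE norm_lact. Qed.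

Let dual_act_fun (f : dual Z) (a : A) : Z -> R[i]^o := fun z => f (lact a z).

Let dual_act_functional f a : dual_act_fun f a \in bounded_functional.
Proof.
apply/asboolP; split.
  by move=> c u v; rewrite /dual_act_fun lact_linear_r dual_linear.
exists (opnorm f * nrm a) => z.
apply: le_trans (nrm_le_opnorm _ (dual_linear f) (dual_bounded f)) _.
by rewrite -mulrA ler_wpM2l ?lact_le// opnorm_ge0//; exact: dual_bounded.
Qed.

Definition dual_act (f : dual Z) (a : A) : dual Z :=
  Dual (dual_act_functional f a).

Let dual_actA f a b : dual_act f (alg_mul a b) = dual_act (dual_act f a) b.
Proof. by apply/val_inj/funext => z; rewrite /= /dual_act_fun lactA. Qed.

Let dual_act_linear_l a : linear (dual_act^~ a).
Proof. by move=> c f g; apply/val_inj/funext. Qed.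

Let dual_act_linear_r f : linear (dual_act f).
Proof.
move=> c a b; apply/val_inj/funext => z /=.
by rewrite /dual_act_fun lact_linear_l dual_linear.
Qed.

Let norm_dual_act f a : `|dual_act f a| <= `|a| * `|f|.
Proof.
rewrite !dual_normE (nrmE a) -rmorphM lecR.
have fb := dual_bounded f.
apply: opnorm_le => [|z]; first by rewrite mulr_ge0 ?nrm_ge0// opnorm_ge0.
apply: le_trans (nrm_le_opnorm _ (dual_linear f) fb) _.
by rewrite [nrm a * _]mulrC -mulrA ler_wpM2l ?lact_le// opnorm_ge0.
Qed.

Definition dual_module : right_module A :=
  RightModule dual_actA dual_act_linear_l dual_act_linear_r norm_dual_act.

Lemma dual_actE (f : dual_module) a z : ract f a z = f (lact a z).
Proof. by []. Qed.

End DualModule.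


Section ModuleTensor.
Context {R : realType} {A : normed_algebra R}.
Variables (X : right_module A) (Z : left_module A).

Definition balancing : set (ptensor X Z) :=
  [set t | exists x a z, t = ptens (ract x a) z - ptens x (lact a z)].

Definition mtensor : normedModType R[i] := quotnorm (linear_span balancing).

Definition mtensor_pi : {linear ptensor X Z -> mtensor} :=
  quotnorm_pi (linear_span balancing).

Definition mtens (x : X) (z : Z) : mtensor := mtensor_pi (ptens x z).

Lemma mtensor_piP t u : mtensor_pi t = mtensor_pi u <->
  t - u \in closure_submod (linear_span balancing).
Proof. exact: quotnorm_piP. Qed.

Lemma mtensor_pi_eq0 t : mtensor_pi t = 0 <->
  t \in closure_submod (linear_span balancing).
Proof. exact: quotnorm_pi_eq0. Qed.

Lemma mtensor_surj (t : mtensor) : exists u, t = mtensor_pi u.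
Proof. by exists (quotnorm_repr t); rewrite -[LHS]quotnorm_reprK. Qed.

Lemma mtensor_normE (t : mtensor) :
  `|t| = (inf [set nrm u | u in [set u | mtensor_pi u = t]])%:C.
Proof. exact: quotnorm_normE. Qed.

Lemma mtens_balanced x a z : mtens (ract x a) z = mtens x (lact a z).
Proof.
apply/mtensor_piP/closure_submodP => e e0.
exists (ptens (ract x a) z - ptens x (lact a z)); last by rewrite subrr nrm0.
by apply/asboolP; apply: sub_gen_smallest; exists x, a, z.
Qed.

End ModuleTensor.

#[global] Opaque mtensor.

Arguments balancing {R A} X Z.
Arguments mtensor_pi {R A} X Z.

Section InducedMap.
Context {R : realType} {A : normed_algebra R}.
Context {X Y : right_module A} (phi : bounded_morphism X Y) (Z : left_module A).

Let pmap : ptensor X Z -> ptensor Y Z :=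
  tensor_lift (fun (x : X) (z : Z) => ptens (phi x) z).

Let bl (z : Z) : linear (fun x : X => ptens (phi x) z).
Proof. by move=> c x x'; rewrite linearP ptensDl ptensZl. Qed.

Let br (x : X) : linear (fun z : Z => ptens (phi x) z).
Proof. by move=> c z z'; rewrite ptensDr ptensZr. Qed.

Let pmap_linear : linear pmap := tensor_lift_linear bl br.

Definition ptensor_map : {linear ptensor X Z -> ptensor Y Z} :=
  HB.pack pmap (GRing.isLinear.Build _ _ _ _ pmap pmap_linear).

Lemma ptensor_mapE (x : X) (z : Z) : ptensor_map (ptens x z) = ptens (phi x) z.
Proof. exact: (tensor_liftE bl br). Qed.

Lemma ptensor_map_bounded : exists2 M : R, 0 < M &
  forall t, nrm (ptensor_map t) <= M * nrm t.
Proof.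
have [M phiM] := bmor_bounded phi.
exists (1 + `|M|); first by rewrite ltr_pwDl.
apply: ptensor_bounded => [|x z]; first by rewrite addr_ge0.
have := ptensor_nrm_le [:: (phi x, z)]; rewrite !big_seq1 ptensor_mapE.
move=> /le_trans; apply; rewrite mulrA ler_wpM2r ?nrm_ge0//.
apply: le_trans (phiM _) _; rewrite ler_wpM2r ?nrm_ge0//.
by rewrite (le_trans (ler_norm _))// lerDr.
Qed.

Let mtensor_map_ker t : mtensor_pi X Z t = 0 ->
  mtensor_pi Y Z (ptensor_map t) = 0.
Proof.
move=> /mtensor_pi_eq0/closure_submodP tN.
have [M M0 hM] := ptensor_map_bounded.
have span0 n : n \in linear_span (balancing X Z) ->
    mtensor_pi Y Z (ptensor_map n) = 0.
  move=> /asboolP; apply: (@smallest_sub _ _ _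
    [set n | mtensor_pi Y Z (ptensor_map n) = 0]).
    split; first by rewrite mksetE (linear0 ptensor_map) linear0.
    by move=> c u v; rewrite !mksetE => u0 v0; rewrite (linearP ptensor_map) linearP u0 v0 scaler0 addr0.
  move=> _ [x [a [z ->]]]; rewrite mksetE (linearB ptensor_map) !ptensor_mapE linearB bmor_act.
  by apply/eqP; rewrite subr_eq0; apply/eqP; exact: mtens_balanced.
apply/mtensor_pi_eq0/closure_submodP => e e0.
have [|n Nn tn] := tN (e / (2 * M)); first by rewrite divr_gt0// mulr_gt0.
have : ptensor_map n \in closure_submod (linear_span (balancing Y Z)).
  by apply/mtensor_pi_eq0; exact: span0.
move=> /closure_submodP/(_ (e / 2))[|m Nm nm]; first by rewrite divr_gt0.
exists m => //; rewrite (_ : _ - m = ptensor_map (t - n) + (ptensor_map n - m)).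
  rewrite (le_lt_trans (ler_nrmD _ _))// (splitr e) ltrD//.
  rewrite (le_lt_trans (hM _))// -ltr_pdivlMl//.
  by rewrite mulrC -mulrA -invfM.
by rewrite (linearB ptensor_map) addrA subrK.
Qed.

Let mmap (t : mtensor X Z) : mtensor Y Z :=
  mtensor_pi Y Z (ptensor_map (quotnorm_repr t)).

Let mmap_pi t : mmap (mtensor_pi X Z t) = mtensor_pi Y Z (ptensor_map t).
Proof.
apply/eqP; rewrite -subr_eq0 -!linearB; apply/eqP/mtensor_map_ker.
apply/eqP; rewrite linearB subr_eq0; apply/eqP; exact: quotnorm_reprK.
Qed.

Let mmap_linear : linear mmap.
Proof.
move=> c u v; have [[t ->] [s ->]] := (mtensor_surj u, mtensor_surj v).
rewrite -[X in mmap X](linearP (mtensor_pi X Z)) !mmap_pi.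
rewrite (linearP ptensor_map).
exact: (linearP (mtensor_pi Y Z)).
Qed.

(* [phi] tensored over [A] with the identity of [Z]. It is defined through
   representatives; by [mtensor_map_pi] it does not depend on them. *)
Definition mtensor_map : {linear mtensor X Z -> mtensor Y Z} :=
  HB.pack mmap (GRing.isLinear.Build _ _ _ _ mmap mmap_linear).

Lemma mtensor_map_pi t :
  mtensor_map (mtensor_pi X Z t) = mtensor_pi Y Z (ptensor_map t).
Proof. exact: mmap_pi. Qed.

Lemma mtensor_mapE (x : X) (z : Z) : mtensor_map (mtens x z) = mtens (phi x) z.
Proof. by rewrite /mtens mtensor_map_pi ptensor_mapE. Qed.

End InducedMap.

Arguments ptensor_map {R A X Y} phi Z.
Arguments mtensor_map {R A X Y} phi Z.

(* An isometric morphism is bounded, so [bounded_morphism] loses nothing here. *)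
Definition extremely_flat (R : realType) (A : normed_algebra R)
    (K : right_module A -> Prop) (Z : left_module A) : Prop :=
  forall (X Y : right_module A) (i : bounded_morphism X Y), K X -> K Y ->
    isometric i -> isometric (mtensor_map i Z).

Definition extremely_injective (R : realType) (A : normed_algebra R)
    (K : right_module A -> Prop) (W : right_module A) : Prop :=
  forall (X Y : right_module A) (i : bounded_morphism X Y), K X -> K Y ->
    isometric i -> forall phi : bounded_morphism X W,
    exists psi : bounded_morphism Y W,
      (forall x, psi (i x) = phi x) /\ opnorm psi = opnorm phi.

(* Main.v *)
Require Import Defs.
From HB Require Import structures.
From mathcomp Require Import all_boot all_order all_algebra.
From mathcomp Require Import all_classical all_reals all_analysis.
From mathcomp.real_closed Require Import complex.

(** Bounded morphisms [X -> Z^*] and bounded functionals on the module tensor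
product of [X] and [Z] are the same thing, with the same norm: [phi] and [F]
correspond when [F (mtens x z) = phi x z] ([functional_of_morphism],
[morphism_of_functional]). For an isometric [i : X -> Y], extending [phi] along
[i] amounts to extending [F] along [mtensor_map i Z].

If [Z] is extremely flat, [mtensor_map i Z] is isometric, so Hahn-Banach extends
[F] along it without increasing the norm ([extend_functional]); the morphism
given by the extended functional has norm at most that of [phi], and at least
that since [i] is isometric.

Conversely, [mtensor_map i Z] is always contractive. To see that it does not
decrease the norm of [t], take a functional [F] of norm at most 1 that attains
the norm at [t] ([norming_functional]). If [Z^*] is extremely injective, the
morphism of [F] extends to one on [Y] of the same norm, that is, [F] factors as
[G \o mtensor_map i Z] with [G] of norm at most 1, whence the norm of
[t] is at most that of its image. *)

Set Implicit Arguments.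
Unset Strict Implicit.
Unset Printing Implicit Defensive.

Import Order.TTheory GRing.Theory Num.Theory.
Import numFieldNormedType.Exports.

Local Open Scope classical_set_scope.
Local Open Scope complex_scope.
Local Open Scope ring_scope.

(** * Consequences of the Hahn-Banach theorem *)

Section HahnBanachCorollaries.
Context {R : realType}.
Implicit Types V W : normedModType R[i].

(** The functional [c *: v |-> c * nrm v] on the line through [v], extended by
Hahn-Banach. *)
Lemma norming_functional V (v : V) : exists F : {linear V -> R[i]^o},
  nrm (F v) = nrm v /\ forall u, nrm (F u) <= nrm u.
Proof.
have [->|v0] := eqVneq v 0.
  by exists \0; split=> [|u]; rewrite /= !nrm0 ?nrm_ge0.
(* On the line through [v], [g] is the coordinate along [v]. *)
have [g [gv _]] := exists_functional v0.
have spanE u : u \in linear_span [set v] -> u = g u *: v.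
  by move=> /linear_span1[c ->]; rewrite linearZ /= gv /GRing.scale /= mulr1.
pose f u : R[i]^o := (nrm v)%:C *: g u.
have [|||| F [Ff Fle]] := @hahn_banach R V (linear_span [set v]) (@nrm R V) f.
- exact: ler_nrmD.
- exact: nrmZ.
- by move=> c u w _ _; rewrite /f linearP scalerDr !scalerA mulrC -scalerA.
- move=> u /spanE uE.
  by rewrite [in leRHS]uE /f !nrmZ nrm_real ger0_norm ?nrm_ge0// mulrC.
exists F; split=> //.
rewrite Ff; last by apply/asboolP; exact: sub_gen_smallest.
by rewrite /f gv nrmZ /nrm normr1 mulr1 -/(nrm _) nrm_real ger0_norm ?nrm_ge0.
Qed.

Definition range_pred V W (T : {linear V -> W}) : {pred W} :=
  [pred w | `[< exists v, T v = w >]].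

Lemma range_pred_submod V W (T : {linear V -> W}) : submod_closed (range_pred T).
Proof.
split; first by apply/asboolP; exists 0; exact: linear0.
move=> c _ _ /asboolP[u <-] /asboolP[v <-].
by apply/asboolP; exists (c *: u + v); rewrite linearP.
Qed.

HB.instance Definition _ V W (T : {linear V -> W}) :=
  GRing.isSubmodClosed.Build _ _ (range_pred T) (range_pred_submod T).

(** An isometry is injective, so [F] is well defined on the range of [T], where
it satisfies the same bound; [T] identifies [V] with a subspace of [W]. *)
Lemma extend_functional V W (T : {linear V -> W}) (F : {linear V -> R[i]^o})
    (M : R) : 0 <= M -> isometric T -> (forall v, nrm (F v) <= M * nrm v) ->
  exists G : {linear W -> R[i]^o},
    (forall v, G (T v) = F v) /\ forall w, nrm (G w) <= M * nrm w.
Proof.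
move=> M0 Tiso FM.
have nT v : nrm (T v) = nrm v by rewrite /nrm Tiso.
(* [F] at a chosen preimage of [w]; the default 0 of [xget] occurs only outside
   the range of [T]. *)
pose f w : R[i]^o := F (xget 0 [set v | T v = w]).
have fT v : f (T v) = F v.
  rewrite /f; congr (F _); apply: xget_unique => // u Tu.
  apply/eqP; rewrite -subr_eq0; apply/eqP/nrm_eq0.
  by rewrite -nT linearB Tu subrr nrm0.
have [|||| G [Gf Gle]] :=
    @hahn_banach R W (range_pred T) (fun w => M * nrm w) f.
- by move=> u w; rewrite -mulrDr ler_wpM2l// ler_nrmD.
- by move=> c w; rewrite nrmZ mulrCA.
- move=> c _ _ /asboolP[u <-] /asboolP[v <-].
  by rewrite -linearP !fT linearP.
- by move=> _ /asboolP[v <-]; rewrite fT nT.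
exists G; split=> // v; rewrite Gf ?fT//.
by apply/asboolP; exists v.
Qed.

End HahnBanachCorollaries.

(** * Bounded linear maps on the module tensor product *)

Section ModuleTensorUniversal.
Context {R : realType} {A : normed_algebra R}.
Variables (X : right_module A) (Z : left_module A).
Implicit Type W : normedModType R[i].

Lemma mtens_linear_l z : linear (fun x => mtens x z : mtensor X Z).
Proof. by move=> c x x'; rewrite /mtens ptensDl ptensZl linearP. Qed.

Lemma mtens_linear_r x : linear (fun z => mtens x z : mtensor X Z).
Proof. by move=> c z z'; rewrite /mtens ptensDr ptensZr linearP. Qed.

Lemma nrm_mtensor_pi t : nrm (mtensor_pi X Z t) <= nrm t.
Proof.
rewrite [leLHS]/nrm mtensor_normE /=; apply: ge_inf; last by exists t.
by exists 0 => _ [u _ <-]; exact: nrm_ge0.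
Qed.

Lemma nrm_mtens x z : nrm (mtens x z : mtensor X Z) <= nrm x * nrm z.
Proof.
apply: le_trans (nrm_mtensor_pi _) _.
by have := ptensor_nrm_le [:: (x, z)]; rewrite !big_seq1.
Qed.

Lemma mtensor_ext W (S T : {linear mtensor X Z -> W}) :
  (forall x z, S (mtens x z) = T (mtens x z)) -> S =1 T.
Proof.
move=> ST t; have [u ->] := mtensor_surj t; have [s ->] := ptensor_sum u.
by rewrite !linear_sum; apply: eq_bigr => p _; exact: ST.
Qed.

(** The norm of [mtensor X Z] is the largest one satisfying [nrm_mtens]: a bound on
elementary tensors passes to the projective tensor product and then to the
infimum over representatives. *)
Lemma mtensor_bounded W (T : {linear mtensor X Z -> W}) (M : R) : 0 <= M ->
  (forall x z, nrm (T (mtens x z)) <= M * (nrm x * nrm z)) ->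
  forall t, nrm (T t) <= M * nrm t.
Proof.
move=> M0 TM t.
pose L : ptensor X Z -> W := T \o mtensor_pi X Z.
have LM u : nrm (L u) <= M * nrm u.
  exact: (@ptensor_bounded _ _ _ _ (T \o mtensor_pi X Z)).
(* For [M = 0] one cannot divide by [M] to compare with the infimum. *)
have [M1|M1] := eqVneq M 0.
  by have [u ->] := mtensor_surj t; rewrite M1 mul0r -(mul0r (nrm u)) -M1 LM.
have {}M0 : 0 < M by rewrite lt0r M1.
rewrite [in leRHS]/nrm mtensor_normE /= -ler_pdivrMl//; apply: lb_le_inf.
  by have [u ->] := mtensor_surj t; exists (nrm u), u.
by move=> _ [u /= <- <-]; rewrite ler_pdivrMl//; exact: LM.
Qed.

(** Universal property of the module tensor product for bounded balanced bilinear
maps. The linear map on the projective tensor product kills the span of the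
balancing elements; boundedness is what makes it kill the closure as well. *)
Lemma mtensor_lift W (b : X -> Z -> W) (M : R) : 0 <= M ->
  (forall z, linear (b^~ z)) -> (forall x, linear (b x)) ->
  (forall x a z, b (ract x a) z = b x (lact a z)) ->
  (forall x z, nrm (b x z) <= M * (nrm x * nrm z)) ->
  exists2 G : {linear mtensor X Z -> W},
    (forall x z, G (mtens x z) = b x z) & forall t, nrm (G t) <= M * nrm t.
Proof.
move=> M0 bl br bA bM.
pose h0 : ptensor X Z -> W := tensor_lift b.
have h0l : linear h0 by exact: (tensor_lift_linear bl br).
pose h : {linear ptensor X Z -> W} :=
  HB.pack h0 (GRing.isLinear.Build _ _ _ _ h0 h0l).
have hE x z : h (ptens x z) = b x z by exact: (tensor_liftE bl br).
have hM : forall t, nrm (h t) <= M * nrm t.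
  by apply: ptensor_bounded => // x z; rewrite hE.
have h_span n : n \in linear_span (balancing X Z) -> h n = 0.
  move=> /asboolP; apply: (@smallest_sub _ _ _ [set n | h n = 0]).
    split; first by rewrite mksetE (linear0 h).
    by move=> c u v; rewrite !mksetE (linearP h) => -> ->; rewrite scaler0 addr0.
  by move=> _ [x [a [z ->]]]; rewrite mksetE (linearB h) !hE bA subrr.
have h_ker t : mtensor_pi X Z t = 0 -> h t = 0.
  move=> /mtensor_pi_eq0/closure_submodP tN; apply: nrm_eq0.
  apply/le_anti; rewrite nrm_ge0 andbT; apply/ler_addgt0Pl => e e0.
  have M1 : 0 < 1 + M by rewrite ltr_pwDl.
  have [|n Nn tn] := tN (e / (1 + M)); first by rewrite divr_gt0.
  rewrite -(subr0 (h t)) -(h_span _ Nn) -(linearB h) addr0.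
  apply: le_trans (hM _) _; move: (ltW tn); rewrite ler_pdivlMr// => /(le_trans _).
  by apply; rewrite mulrC ler_wpM2l ?nrm_ge0// lerDr.
pose g (t : mtensor X Z) : W := h (quotnorm_repr t).
have g_pi t : g (mtensor_pi X Z t) = h t.
  apply/eqP; rewrite -subr_eq0 -(linearB h); apply/eqP/h_ker.
  by rewrite linearB; apply/eqP; rewrite subr_eq0; apply/eqP; exact: quotnorm_reprK.
have gl : linear g.
  move=> c u v; have [[t ->] [s ->]] := (mtensor_surj u, mtensor_surj v).
  by rewrite -[X in g X](linearP (mtensor_pi X Z)) !g_pi (linearP h).
pose G : {linear mtensor X Z -> W} := HB.pack g (GRing.isLinear.Build _ _ _ _ g gl).
have GE x z : G (mtens x z) = b x z by rewrite -hE; exact: g_pi.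
by exists G => //; apply: mtensor_bounded => // x z; rewrite GE.
Qed.

End ModuleTensorUniversal.

(** * Functionals on the tensor product and morphisms into the dual module *)

Section Adjunction.
Context {R : realType} {A : normed_algebra R}.
Variables (X : right_module A) (Z : left_module A).

Lemma functional_of_morphism (phi : bounded_morphism X (dual_module Z)) :
  exists2 F : {linear mtensor X Z -> R[i]^o},
    (forall x z, F (mtens x z) = (phi x : dual Z) z) &
    forall t, nrm (F t) <= opnorm phi * nrm t.
Proof.
have pb := bmor_bounded phi.
apply: mtensor_lift => [|z c x x'|x|x a z|x z].
- exact: opnorm_ge0.
- by rewrite linearP.
- exact: dual_linear.
- by rewrite bmor_act.
apply: le_trans (nrm_le_opnorm _ (dual_linear _) (dual_bounded _)) _.
rewrite mulrA ler_wpM2r ?nrm_ge0//.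
exact: (nrm_le_opnorm (f := phi) _ (linearP phi) pb).
Qed.

(** [mtens_balanced] makes the map [x |-> (z |-> F (mtens x z))] commute with the
action of [A]. *)
Lemma morphism_of_functional (F : {linear mtensor X Z -> R[i]^o}) (M : R) :
  0 <= M -> (forall t, nrm (F t) <= M * nrm t) ->
  exists2 phi : bounded_morphism X (dual_module Z),
    (forall x z, (phi x : dual Z) z = F (mtens x z)) & opnorm phi <= M.
Proof.
move=> M0 FM.
have Fb x z : nrm (F (mtens x z)) <= M * nrm x * nrm z.
  by rewrite -mulrA (le_trans (FM _))// ler_wpM2l// nrm_mtens.
have funP x : (fun z : Z => F (mtens x z) : R[i]^o) \in bounded_functional.
  apply/asboolP; split; last by exists (M * nrm x) => z; exact: Fb.
  by move=> c z z'; rewrite mtens_linear_r linearP.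
pose p x : dual_module Z := Dual (funP x).
have pl : linear p.
  move=> c x x'; apply/val_inj/funext => z.
  by rewrite /= mtens_linear_l linearP.
have pM x : nrm (p x) <= M * nrm x.
  rewrite [leLHS]/nrm dual_normE /=; apply: opnorm_le => [|z]; last exact: Fb.
  by rewrite mulr_ge0 ?nrm_ge0.
pose P : {linear X -> dual_module Z} :=
  HB.pack p (GRing.isLinear.Build _ _ _ _ p pl).
have PA x a : P (ract x a) = ract (P x) a.
  by apply/val_inj/funext => z; rewrite /= mtens_balanced.
exists (BoundedMorphism PA (ex_intro _ M pM)) => //.
exact: opnorm_le.
Qed.

End Adjunction.

(** * Isometric morphisms *)

Section Isometric.
Context {R : realType} {A : normed_algebra R}.
Variables (X Y : right_module A) (i : bounded_morphism X Y) (Z : left_module A).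
Hypothesis i_iso : isometric i.

Lemma nrm_isometric x : nrm (i x) = nrm x.
Proof. by rewrite /nrm i_iso. Qed.

Lemma nrm_mtensor_map t : nrm (mtensor_map i Z t) <= nrm t.
Proof.
rewrite -[leRHS]mul1r; apply: mtensor_bounded => // x z.
by rewrite mtensor_mapE mul1r -nrm_isometric nrm_mtens.
Qed.

(** [i] maps the unit ball of [X] into that of [Y], so the supremum defining
[opnorm psi] is over a larger set. *)
Lemma opnorm_extension (W : normedModType R[i]) (phi : X -> W) (psi : Y -> W) :
  bounded_op psi -> (forall x, psi (i x) = phi x) -> opnorm phi <= opnorm psi.
Proof.
move=> psib psiE; apply: ge_sup; first by exists (nrm (phi 0)), 0; rewrite ?mksetE ?nrm0.
move=> _ [x x1 <-]; rewrite -psiE; apply: opnorm_ub => //.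
by rewrite nrm_isometric.
Qed.

End Isometric.

Theorem mainTheorem5 (R : realType) (A : normed_algebra R)
    (K : right_module A -> Prop) (Z : left_module A) :
  extremely_flat K Z <-> extremely_injective K (dual_module Z).
Proof.
split=> [flat X Y i KX KY i_iso phi | inj X Y i KX KY i_iso t].
- have phi0 : 0 <= opnorm phi by exact/opnorm_ge0/bmor_bounded.
  have [F FE FM] := functional_of_morphism phi.
  have [G [GF GM]] := extend_functional phi0 (flat _ _ i KX KY i_iso) FM.
  have [psi psiE psiM] := morphism_of_functional phi0 GM.
  have psi_i x : psi (i x) = phi x.
    apply/val_inj/funext => z; apply: etrans (FE x z).
    by apply: etrans (psiE (i x) z) _; rewrite -mtensor_mapE; exact: GF.
  exists psi; split=> //; apply/le_anti; rewrite psiM /=.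
  exact: opnorm_extension (bmor_bounded psi) psi_i.
- suff e : nrm (mtensor_map i Z t) = nrm t by rewrite [LHS]nrmE e -nrmE.
  apply/le_anti; rewrite nrm_mtensor_map//=.
  have [F [Ft F1]] := norming_functional t.
  have [|phi phiE phi1] := @morphism_of_functional _ _ _ _ F 1 ler01.
    by move=> u; rewrite mul1r.
  have [psi [psi_i psi_phi]] := inj _ _ i KX KY i_iso phi.
  have [G GE GM] := functional_of_morphism psi.
  have GF : F =1 G \o mtensor_map i Z.
    apply: mtensor_ext => x z; transitivity (G (mtens (i x) z)).
      by apply: etrans (esym (phiE x z)) _; rewrite -psi_i; exact: esym (GE _ _).
    by rewrite -mtensor_mapE.
  rewrite -Ft GF; apply: le_trans (GM _) _; rewrite psi_phi -[leRHS]mul1r.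
  by rewrite ler_wpM2r ?nrm_ge0.
Qed.
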